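(* Let $\mathcal{T}=A\oplus(P,g)\oplus Q$ be a triole algebra. A graded derivation of $\mathcal{T}$ of degree $0$ is a triple $X_0=(X_0^A,X_0^P,X_0^Q)$ of operators (the restrictions of $X_0$ to $A$, $P$, $Q$), where $X_0^A\in D(A)$ is an ordinary derivation of $A$, and $X_0^P\in\mathrm{Der}(P)$, $X_0^Q\in\mathrm{Der}(Q)$ are two Der-operators with shared scalar symbol $\sigma(X_0^P)=\sigma(X_0^Q)=X_0^A$, such that $$X_0^Q\big(g(p_1,p_2)\big)=g\big(X_0^P(p_1),p_2\big)+g\big(p_1,X_0^P(p_2)\big)\qquad\text{for all }p_1,p_2\in P.$$
   Context: $\mathbb{K}$ is a field of characteristic zero. A triole algebra $\mathcal{T}=A\oplus(P,g)\oplus Q$ is a $\mathbb{Z}$-graded commutative $\mathbb{K}$-algebra with $\mathcal{T}_0=A$ a commutative unital $\mathbb{K}$-algebra, $\mathcal{T}_1=P$ and $\mathcal{T}_2=Q$ $A$-modules, all other components zero; the products $A\cdot A$, $A\cdot P$, $A\cdot Q$ are the algebra and module structures, $p_1\cdot p_2:=g(p_1,p_2)$ for an $A$-bilinear form $g:P\times P\to Q$, and $Q\cdot Q=0$ (also $P\cdot Q=0$ for degree reasons). A graded derivation of degree $0$ is a $\mathbb{K}$-linear map $X:\mathcal{T}\to\mathcal{T}$ preserving degrees with $X(st)=X(s)t+sX(t)$ for all $s,t\in\mathcal{T}$. $D(A)$ is the $A$-module of $\mathbb{K}$-linear derivations of $A$. A Der-operator in an $A$-module $R$ is a $\mathbb{K}$-linear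 map $\nabla:R\to R$ together with a derivation $\sigma(\nabla)\in D(A)$ (its scalar symbol) such that $\nabla(ar)=\sigma(\nabla)(a)r+a\nabla(r)$ for $a\in A$, $r\in R$; $\mathrm{Der}(R)$ denotes the set of Der-operators. *)

(* Defs.v *)
From HB Require Import structures.
From mathcomp Require Import all_boot all_order all_algebra.
From mathcomp Require Import sesquilinear.

Set Implicit Arguments.
Unset Strict Implicit.
Unset Printing Implicit Defensive.

Import GRing.Theory.
Local Open Scope ring_scope.

(* An A-module R seen as a K-vector space through the structure map k |-> k%:A
   of the K-algebra A. *)
Definition res_scalars (K : fieldType) (A : comAlgType K) (R : lmodType A) : Type := R.

Section ResScalars.
Variables (K : fieldType) (A : comAlgType K) (R : lmodType A).

HB.instance Definition _ := GRing.Zmodule.on (res_scalars R).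

Definition res_scale (k : K) (r : res_scalars R) : res_scalars R :=
  (k%:A : A) *: (r : R).

Fact res_scaleA k l r : res_scale k (res_scale l r) = res_scale (k * l) r.
Proof. by rewrite /res_scale scalerA -scalerAl mul1r scalerA. Qed.

Fact res_scale1 : left_id 1 res_scale.
Proof. by move=> r; rewrite /res_scale !scale1r. Qed.

Fact res_scaleDr : right_distributive res_scale +%R.
Proof. by move=> k r s; exact: scalerDr. Qed.

Fact res_scaleDl r : {morph res_scale^~ r : k l / k + l}.
Proof. by move=> k l; rewrite /res_scale scalerDl; exact: scalerDl. Qed.

HB.instance Definition _ := GRing.Zmodule_isLmodule.Build K (res_scalars R)
  res_scaleA res_scale1 res_scaleDr res_scaleDl.

End ResScalars.

(* The bilinear form [g] occurs in the type of the total space only to select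
   the multiplication. *)
Definition triole (K : fieldType) (A : comAlgType K) (P Q : lmodType A)
    (g : {bilinear P -> P -> Q}) : Type :=
  (A * res_scalars P * res_scalars Q)%type.

Section Triole.
Variables (K : fieldType) (A : comAlgType K) (P Q : lmodType A).
Variable g : {bilinear P -> P -> Q}.
Local Notation T := (triole g).
Implicit Types (s t u : T) (k : K).

HB.instance Definition _ := GRing.Lmodule.on T.

Definition projA t : A := t.1.1.
Definition projP t : P := t.1.2.
Definition projQ t : Q := t.2.

Definition mkT (a : A) (p : P) (q : Q) : T := (a, p, q).

Definition inA (a : A) : T := mkT a 0 0.
Definition inP (p : P) : T := mkT 0 p 0.
Definition inQ (q : Q) : T := mkT 0 0 q.

Definition triole_one : T := inA 1.

Definition triole_mul s t : T :=
  mkT (projA s * projA t)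
      (projA s *: projP t + projA t *: projP s)
      (projA s *: projQ t + projA t *: projQ s + g (projP s) (projP t)).

Fact triole_mulA : associative triole_mul.
Proof.
move=> [[a p] q] [[b p'] q'] [[c p''] q'']; rewrite /triole_mul /mkT /projA /projP /projQ /=.
congr (_, _, _); first exact: mulrA.
  by rewrite !scalerDr !scalerA -addrA (mulrC c a) (mulrC c b).
rewrite !linearDr !linearDl !linearZr !linearZl /= !scalerDr !scalerA.
rewrite (mulrC c a) (mulrC c b) -!addrA; congr (_ + (_ + _)).
by rewrite addrC -!addrA; congr (_ + _); rewrite addrC -addrA.
Qed.

Fact triole_mul1l : left_id triole_one triole_mul.
Proof.
move=> [[a p] q]; rewrite /triole_mul /mkT /projA /projP /projQ /=.
by rewrite mul1r !scale1r !scaler0 !addr0 linear0l addr0.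
Qed.

Fact triole_mul1r : right_id triole_one triole_mul.
Proof.
move=> [[a p] q]; rewrite /triole_mul /mkT /projA /projP /projQ /=.
by rewrite mulr1 !scale1r !scaler0 !add0r linear0r addr0.
Qed.

Fact triole_mulDl : left_distributive triole_mul +%R.
Proof.
move=> [[a p] q] [[b p'] q'] [[c p''] q'']; rewrite /triole_mul /mkT /projA /projP /projQ /=.
congr (_, _, _); first exact: mulrDl.
  by rewrite scalerDl scalerDr addrACA.
by rewrite scalerDl scalerDr linearDl /= [X in X + _]addrACA; exact: addrACA.
Qed.

Fact triole_mulDr : right_distributive triole_mul +%R.
Proof.
move=> [[a p] q] [[b p'] q'] [[c p''] q'']; rewrite /triole_mul /mkT /projA /projP /projQ /=.
congr (_, _, _); first exact: mulrDr.
  by rewrite scalerDl scalerDr addrACA.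
by rewrite scalerDl scalerDr linearDr /= [X in X + _]addrACA; exact: addrACA.
Qed.

Fact triole_one_neq0 : triole_one != 0.
Proof. by apply/eqP => -[] /eqP; rewrite oner_eq0. Qed.

HB.instance Definition _ := GRing.Zmodule_isNzRing.Build T
  triole_mulA triole_mul1l triole_mul1r triole_mulDl triole_mulDr triole_one_neq0.

Fact triole_scaleAl k s t : k *: (s * t) = (k *: s) * t.
Proof.
case: s t => [[a p] q] [[b p'] q'].
congr (_, _, _); rewrite /projA /projP /projQ /=.
- exact: scalerAl.
- by rewrite /= {1}/GRing.scale /= /res_scale scalerDr !scalerA -scalerAl mul1r mulrC.
- rewrite {1}/GRing.scale /= /res_scale !scalerDr !scalerA -scalerAl mul1r mulrC.
  by rewrite linearZl.
Qed.

HB.instance Definition _ := GRing.Lmodule_isLalgebra.Build K T triole_scaleAl.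

Fact triole_scaleAr k s t : k *: (s * t) = s * (k *: t).
Proof.
case: s t => [[a p] q] [[b p'] q'].
congr (_, _, _); rewrite /projA /projP /projQ /=.
- exact: scalerAr.
- rewrite {1}/GRing.scale /= /res_scale [RHS]/=.
  by rewrite scalerDr !scalerA !mulr_algl mulr_algr.
- rewrite {1}/GRing.scale /= /res_scale [RHS]/= !scalerDr.
  by rewrite linearZr /= !scalerA !mulr_algl mulr_algr.
Qed.

HB.instance Definition _ := GRing.Lalgebra_isAlgebra.Build K T triole_scaleAr.

(* [homog n] is the homogeneous component of degree [n]. *)
Definition homog (n : int) : pred T := fun t =>
  match n with
  | Posz 0 => (projP t == 0) && (projQ t == 0)
  | Posz 1 => (projA t == 0) && (projQ t == 0)
  | Posz 2 => (projA t == 0) && (projP t == 0)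
  | _ => t == 0
  end.

Lemma homogE (n : int) t :
  homog n t = [&& (n == 0) || (projA t == 0), (n == 1) || (projP t == 0)
                & (n == 2) || (projQ t == 0)].
Proof.
case: t => [[a p] q]; have tE : ((a, p, q) == 0 :> T) = [&& a == 0, p == 0 & q == 0].
  apply/eqP/and3P => [[-> -> ->] | [/eqP-> /eqP-> /eqP->] //].
  by rewrite !eqxx.
by case: n => [[|[|[|n]]]|n]; rewrite /homog ?tE //= andbT.
Qed.

Lemma projAM s t : projA (s * t) = projA s * projA t.
Proof. by []. Qed.

Lemma projPM s t : projP (s * t) = projA s *: projP t + projA t *: projP s.
Proof. by []. Qed.

Lemma projQM s t :
  projQ (s * t) = projA s *: projQ t + projA t *: projQ s + g (projP s) (projP t).
Proof. by []. Qed.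

Lemma homogM (m n : int) s t : homog m s -> homog n t -> homog (m + n) (s * t).
Proof.
rewrite !homogE projAM projPM projQM => /and3P[a0 p0 q0] /and3P[a0' p0' q0'].
have prod0 (b1 b2 b : bool) (U V W : zmodType) (f : U -> V -> W)
      (x : U) (y : V) :
    (forall y', f 0 y' = 0) -> (forall x', f x' 0 = 0) ->
    b1 || (x == 0) -> b2 || (y == 0) -> (b1 -> b2 -> b) -> b || (f x y == 0).
  move=> f0l f0r; case: b1 => /= [_|/eqP->]; last by rewrite f0l eqxx orbT.
  by case: b2 => /= [_ -> //|/eqP->]; rewrite f0r eqxx orbT.
have sum0 (b : bool) (U : zmodType) (x y : U) :
    b || (x == 0) -> b || (y == 0) -> b || (x + y == 0).
  by case: b => //= /eqP-> /eqP->; rewrite addr0.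
have deg (i j k : int) : (i + j = k) -> m == i -> n == j -> m + n == k.
  by move=> <- /eqP-> /eqP->.
apply/and3P; split.
- by apply: (prod0 (m == 0) (n == 0) _ _ _ _ *%R) => //; [exact: mul0r|exact: mulr0|exact: deg].
- apply: sum0.
  + by apply: (prod0 (m == 0) (n == 1) _ _ _ _ *:%R) => //; [exact: scale0r|exact: scaler0|exact: deg].
  + apply: (prod0 (n == 0) (m == 1) _ _ _ _ *:%R) => //; [exact: scale0r|exact: scaler0|].
    by move=> ? ?; exact: (deg 1 0).
- apply: (sum0); first apply: sum0.
  + by apply: (prod0 (m == 0) (n == 2) _ _ _ _ *:%R) => //; [exact: scale0r|exact: scaler0|exact: deg].
  + apply: (prod0 (n == 0) (m == 2) _ _ _ _ *:%R) => //; [exact: scale0r|exact: scaler0|].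
    by move=> ? ?; exact: (deg 2 0).
  + by apply: (prod0 (m == 1) (n == 1) _ _ _ _ g) => //; [exact: linear0l|exact: linear0r|exact: deg].
Qed.

(* T is Z-graded commutative when s t = (-1)^(i j) t s for homogeneous s, t of
   degrees i, j if [koszul] is true, and when s t = t s if it is false. *)
Definition commutation_sign (koszul : bool) (i j : int) : K :=
  if koszul then (-1) ^ (i * j) else 1.

Definition graded_commutative (koszul : bool) : Prop :=
  forall (i j : int) (s t : T), homog i s -> homog j t ->
    s * t = commutation_sign koszul i j *: (t * s).

Lemma graded_commutativeE (koszul : bool) :
  graded_commutative koszul <->
  forall p p' : P, g p p' = (-1) ^+ koszul *: g p' p.
Proof.
have scaleQ k t : projQ (k *: t) = k%:A *: projQ t by [].
have scaleP k t : projP (k *: t) = k%:A *: projP t by [].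
have scaleA k t : projA (k *: t) = k *: projA t by [].
have eqT s t : projA s = projA t -> projP s = projP t -> projQ s = projQ t -> s = t.
  by case: s t => [[? ?] ?] [[? ?] ?] /= ; rewrite /projA /projP /projQ /= => -> -> ->.
split=> [cT p p'|gC i j s t].
  have h1 (x : P) : homog 1 (inP x) by rewrite /homog /= !eqxx.
  have := congr1 projQ (cT 1 1 _ _ (h1 p) (h1 p')).
  rewrite scaleQ !projQM /= !scale0r !add0r => ->.
  rewrite /commutation_sign; case: koszul {cT} => /=; last by rewrite expr0 !scale1r.
  by rewrite (_ : (-1) ^ (1 * 1) = -1 :> K) // expr1 -scaleN1r.
have g0l x : g 0 x = 0 by exact: linear0l.
have g0r x : g x 0 = 0 by exact: linear0r.
rewrite !homogE => /and3P[a0 p0 _] /and3P[a0' p0' _].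
have [ij0|] := boolP ((i == 0) || (j == 0)).
  have -> : commutation_sign koszul i j = 1.
    rewrite /commutation_sign; case: koszul {gC} => //.
    by case/orP: ij0 => /eqP->; rewrite ?mul0r ?mulr0 expr0z.
  have [gst gts] : g (projP s) (projP t) = 0 /\ g (projP t) (projP s) = 0.
    case/orP: ij0 => /eqP ij0; first by move: p0; rewrite ij0 /= => /eqP->; split.
    by move: p0'; rewrite ij0 /= => /eqP->; split.
  rewrite scale1r; apply: eqT; first exact: mulrC.
    by rewrite !projPM addrC.
  by rewrite !projQM gst gts !addr0 addrC.
case/norP => i0 j0; move: a0 a0'; rewrite (negPf i0) (negPf j0) /= => /eqP a0 /eqP a0'.
apply: eqT; rewrite ?scaleA ?scaleP ?scaleQ ?projAM ?projPM ?projQM a0 a0'.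
- by rewrite mulr0 scaler0.
- by rewrite !scale0r addr0 scaler0.
rewrite !scale0r !add0r.
case/orP: p0 => [/eqP ->|/eqP->]; last by rewrite g0l g0r scaler0.
case/orP: p0' => [/eqP ->|/eqP->]; last by rewrite g0l g0r scaler0.
rewrite gC /commutation_sign; case: koszul {gC}; last by rewrite expr0 !scale1r.
by rewrite (_ : (-1) ^ (1 * 1) = -1 :> K) // expr1 -scaleN1r.
Qed.

End Triole.

Arguments homog {K A P Q g} n t.
Arguments graded_commutative {K A P Q} g koszul.
Arguments inA {K A P Q g} a.
Arguments inP {K A P Q g} p.
Arguments inQ {K A P Q g} q.

Record derivation (K : fieldType) (B : algType K) := Derivation {
  der_map :> {linear B -> B};
  der_leibniz : forall s t : B, der_map (s * t) = der_map s * t + s * der_map t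
}.

Record graded_derivation0 (K : fieldType) (A : comAlgType K) (P Q : lmodType A)
    (g : {bilinear P -> P -> Q}) := GradedDerivation0 {
  gder0_der :> derivation (triole g);
  gder0_homog : forall (n : int) (t : triole g), homog n t -> homog n (gder0_der t)
}.

(* The symbol is part of the data: it is not determined by the operator when
   R is not a faithful module. *)
Record der_operator (K : fieldType) (A : comAlgType K) (R : lmodType A) :=
  DerOperator {
  derop_map :> {linear res_scalars R -> res_scalars R};
  symbol : derivation A;
  derop_law : forall (a : A) (r : R),
    (derop_map (a *: r : R) : R) = symbol a *: r + a *: (derop_map r : R)
}.

Definition restrictions (K : fieldType) (A : comAlgType K) (P Q : lmodType A)
    (g : {bilinear P -> P -> Q}) (X : triole g -> triole g)
    (XA : A -> A) (XP : P -> P) (XQ : Q -> Q) : Prop :=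
  [/\ forall a, X (inA a) = inA (XA a),
      forall p, X (inP p) = inP (XP p)
    & forall q, X (inQ q) = inQ (XQ q)].

Definition compatible_triple (K : fieldType) (A : comAlgType K)
    (P Q : lmodType A) (g : {bilinear P -> P -> Q})
    (XA : derivation A) (XP : der_operator P) (XQ : der_operator Q) : Prop :=
  [/\ symbol XP =1 XA,
      symbol XQ =1 XA
    & forall p1 p2 : P, XQ (g p1 p2) = g (XP p1) p2 + g p1 (XP p2)].

(* Main.v *)
(* The Leibniz rule is additive in each argument and every element is the sum of
   its three components, so the rule only has to be read on products of
   homogeneous elements: on A.A it is the derivation law, on A.P and A.Q the
   Der-operator law (with the same symbol), on P.P the compatibility with g, and
   all other products vanish. *)
Require Import Defs.
From HB Require Import structures.
From mathcomp Require Import all_boot all_order all_algebra.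
From mathcomp Require Import sesquilinear.

Set Implicit Arguments.
Unset Strict Implicit.
Unset Printing Implicit Defensive.

Import GRing.Theory.
Local Open Scope ring_scope.

(** * Components of a triole algebra and their products *)

Section TrioleComponents.
Variables (K : fieldType) (A : comAlgType K) (P Q : lmodType A).
Variable g : {bilinear P -> P -> Q}.
Local Notation T := (triole g).
Implicit Types (a b : A) (p : P) (q : Q) (s t : T).

Lemma triole_eqP s t :
  projA s = projA t -> projP s = projP t -> projQ s = projQ t -> s = t.
Proof.
by case: s t => [[a p] q] [[a' p'] q']; rewrite /projA /projP /projQ /= => -> -> ->.
Qed.

Lemma triole_split t : t = inA (projA t) + inP (projP t) + inQ (projQ t).
Proof.
by case: t => [[a p] q]; apply: triole_eqP; rewrite /projA /projP /projQ /= ?addr0 ?add0r.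
Qed.

(** This and the next three lemmas turn each nonvanishing product of components into a product in
    [T], where the Leibniz rule of a derivation of [T] applies. *)
Lemma inA_mul a b : inA (a * b) = inA a * inA b :> T.
Proof.
by apply: triole_eqP; rewrite ?projAM ?projPM ?projQM /= ?scaler0 ?linear0l ?addr0.
Qed.

Lemma inP_scale a p : inP (a *: p) = inA a * inP p :> T.
Proof.
by apply: triole_eqP;
  rewrite ?projAM ?projPM ?projQM /= ?scaler0 ?scale0r ?mulr0 ?linear0l ?addr0.
Qed.

Lemma inQ_scale a q : inQ (a *: q) = inA a * inQ q :> T.
Proof.
by apply: triole_eqP;
  rewrite ?projAM ?projPM ?projQM /= ?scaler0 ?scale0r ?mulr0 ?linear0l ?addr0.
Qed.

Lemma inQ_form p1 p2 : inQ (g p1 p2) = inP p1 * inP p2 :> T.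
Proof.
by apply: triole_eqP;
  rewrite ?projAM ?projPM ?projQM /= ?scaler0 ?scale0r ?mulr0 ?addr0 ?add0r.
Qed.

Lemma inA_linear : linear (inA : A -> T).
Proof.
by move=> k a b; apply: triole_eqP; rewrite /projA /projP /projQ /= ?scaler0 ?addr0.
Qed.

Lemma inP_linear : linear (inP : res_scalars P -> T).
Proof.
by move=> k a b; apply: triole_eqP; rewrite /projA /projP /projQ /= ?scaler0 ?addr0.
Qed.

Lemma inQ_linear : linear (inQ : res_scalars Q -> T).
Proof.
by move=> k a b; apply: triole_eqP; rewrite /projA /projP /projQ /= ?scaler0 ?addr0.
Qed.

End TrioleComponents.

(** * From a graded derivation to its compatible triple *)

Section Restriction.
Variables (K : fieldType) (A : comAlgType K) (P Q : lmodType A).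
Variables (g : {bilinear P -> P -> Q}) (X : graded_derivation0 g).

Definition restrA (a : A) : A := projA (X (inA a)).
Definition restrP (p : res_scalars P) : res_scalars P := projP (X (inP p)).
Definition restrQ (q : res_scalars Q) : res_scalars Q := projQ (X (inQ q)).

Fact restrA_linear : linear restrA.
Proof. by move=> k a b; rewrite /restrA inA_linear linearP. Qed.

Fact restrP_linear : linear restrP.
Proof. by move=> k p p'; rewrite /restrP inP_linear linearP. Qed.

Fact restrQ_linear : linear restrQ.
Proof. by move=> k q q'; rewrite /restrQ inQ_linear linearP. Qed.

HB.instance Definition _ := GRing.isLinear.Build K A A _ restrA restrA_linear.
HB.instance Definition _ :=
  GRing.isLinear.Build K (res_scalars P) (res_scalars P) _ restrP restrP_linear.
HB.instance Definition _ :=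
  GRing.isLinear.Build K (res_scalars Q) (res_scalars Q) _ restrQ restrQ_linear.

(** Preservation of degree kills the two off-degree components of [X] on each summand, so the
    projections in [restrA], [restrP], [restrQ] lose nothing. *)
Lemma restrictions_restr : restrictions X restrA restrP restrQ.
Proof.
split=> x; apply: triole_eqP => //=.
- by have := gder0_homog X (n := 0) (t := inA x); rewrite /= !eqxx => /(_ isT)/andP[/eqP].
- by have := gder0_homog X (n := 0) (t := inA x); rewrite /= !eqxx => /(_ isT)/andP[_ /eqP].
- by have := gder0_homog X (n := 1) (t := inP x); rewrite /= !eqxx => /(_ isT)/andP[/eqP].
- by have := gder0_homog X (n := 1) (t := inP x); rewrite /= !eqxx => /(_ isT)/andP[_ /eqP].
- by have := gder0_homog X (n := 2) (t := inQ x); rewrite /= !eqxx => /(_ isT)/andP[/eqP].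
- by have := gder0_homog X (n := 2) (t := inQ x); rewrite /= !eqxx => /(_ isT)/andP[_ /eqP].
Qed.

(** [projA] carries sums and products of [T] to those of [A] by computation, so the Leibniz rule
    descends. *)
Fact restrA_leibniz a b : restrA (a * b) = restrA a * b + a * restrA b.
Proof. by rewrite {1}/restrA inA_mul der_leibniz. Qed.

Definition restrA_der := @Derivation K A restrA restrA_leibniz.

Fact restrP_law (a : A) (p : P) :
  (restrP (a *: p : P) : P) = restrA_der a *: p + a *: (restrP p : P).
Proof.
have [XAE XPE _] := restrictions_restr.
(* Folding both Leibniz terms back into the image of [inP] lets [projP] read them off. *)
by rewrite [LHS]/restrP inP_scale der_leibniz XAE XPE -!inP_scale.
Qed.

Fact restrQ_law (a : A) (q : Q) :
  (restrQ (a *: q : Q) : Q) = restrA_der a *: q + a *: (restrQ q : Q).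
Proof.
have [XAE _ XQE] := restrictions_restr.
by rewrite [LHS]/restrQ inQ_scale der_leibniz XAE XQE -!inQ_scale.
Qed.

(** Both operators are given the same derivation as symbol, so the symbol conditions of
    [compatible_triple] hold by reflexivity. *)
Definition restrP_op := @DerOperator K A P restrP restrA_der restrP_law.
Definition restrQ_op := @DerOperator K A Q restrQ restrA_der restrQ_law.

Lemma compatible_restr : compatible_triple g restrA_der restrP_op restrQ_op.
Proof.
have [_ XPE _] := restrictions_restr.
by split=> // p1 p2; rewrite /= [LHS]/restrQ inQ_form der_leibniz !XPE -!inQ_form.
Qed.

End Restriction.

(* [linearD] does not rewrite here: the sum is that of [R], not of
   [res_scalars R]. *)
Lemma derop_add (K : fieldType) (A : comAlgType K) (R : lmodType A)
    (D : der_operator R) (r s : R) : D (r + s : R) = (D r : R) + (D s : R).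
Proof. exact: (linearD (derop_map D)). Qed.

(** * From a compatible triple to a graded derivation *)

Section Extension.
Variables (K : fieldType) (A : comAlgType K) (P Q : lmodType A).
Variable g : {bilinear P -> P -> Q}.
Variables (XA : derivation A) (XP : der_operator P) (XQ : der_operator Q).

Definition extend (t : triole g) : triole g :=
  mkT g (XA (projA t)) (XP (projP t)) (XQ (projQ t)).

Fact extend_linear : linear extend.
Proof.
move=> k s t; apply: triole_eqP; [exact: (linearP XA)|exact: (linearP XP)|].
exact: (linearP XQ).
Qed.

HB.instance Definition _ :=
  GRing.isLinear.Build K (triole g) (triole g) _ extend extend_linear.

Lemma extend_restrictions : restrictions extend XA XP XQ.
Proof.
by split=> x; apply: triole_eqP => //=; rewrite /projA /projP /projQ /=;
  exact: linear0.
Qed.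

Hypothesis XE : compatible_triple g XA XP XQ.

Fact extend_leibniz s t : extend (s * t) = extend s * t + s * extend t.
Proof.
have [sP sQ XQg] := XE; apply: triole_eqP.
- exact: der_leibniz.
- apply: etrans (derop_add XP _ _) _; rewrite !derop_law !sP.
  (* A projection of a sum in [T] computes to the sum of the projections; it remains to regroup four
     terms by the factor [projA s] or [projA t] they come from. *)
  apply: etrans _ (esym (congr2 +%R (projPM (extend s) t) (projPM s (extend t)))).
  by rewrite [RHS]addrACA; congr (_ + _); exact: addrC.
- apply: etrans (derop_add XQ _ _) _; rewrite XQg.
  apply: etrans (congr2 +%R (derop_add XQ _ _) erefl) _; rewrite !derop_law !sQ.
  apply: etrans _ (esym (congr2 +%R (projQM (extend s) t) (projQM s (extend t)))).
  (* The two [g] terms are split off first; the other four regroup as in the [P] component. *)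
  rewrite [RHS]addrACA; congr (_ + _).
  by rewrite [RHS]addrACA; congr (_ + _); exact: addrC.
Qed.

(** By [homogE], homogeneity is the vanishing of the off-degree components, which linear maps
    applied componentwise preserve. *)
Fact extend_homog n t : homog n t -> homog n (extend t).
Proof.
rewrite !homogE => /and3P[nA nP nQ]; apply/and3P; split.
- case/orP: nA => [->//|/eqP A0].
  by apply/orP; right; apply/eqP; rewrite [LHS]/(XA _) A0; exact: (linear0 XA).
- case/orP: nP => [->//|/eqP P0].
  by apply/orP; right; apply/eqP; rewrite [LHS]/(XP _) P0; exact: (linear0 XP).
- case/orP: nQ => [->//|/eqP Q0].
  by apply/orP; right; apply/eqP; rewrite [LHS]/(XQ _) Q0; exact: (linear0 XQ).
Qed.

Definition extend_der := @Derivation K (triole g) extend extend_leibniz.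
Definition extend_gder := @GradedDerivation0 K A P Q g extend_der extend_homog.

End Extension.

(** Uniqueness of the extension: the three summands span [T], so a linear map is determined on
    them. *)
Lemma restrictions_inj (K : fieldType) (A : comAlgType K) (P Q : lmodType A)
    (g : {bilinear P -> P -> Q}) (X Y : {linear triole g -> triole g}) XA XP XQ :
  restrictions X XA XP XQ -> restrictions Y XA XP XQ -> Y =1 X.
Proof.
move=> [XAE XPE XQE] [YAE YPE YQE] t.
by rewrite (triole_split t) !linearD XAE XPE XQE YAE YPE YQE.
Qed.

Theorem lemma3p1 (K : fieldType) (charK0 : [pchar K] =i pred0)
    (A : comAlgType K) (P Q : lmodType A) (g : {bilinear P -> P -> Q})
    (koszul : bool) (comT : graded_commutative g koszul) :
  (forall X : graded_derivation0 g,
     exists (XA : derivation A) (XP : der_operator P) (XQ : der_operator Q),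
       restrictions X XA XP XQ /\ compatible_triple g XA XP XQ)
  /\
  (forall (XA : derivation A) (XP : der_operator P) (XQ : der_operator Q),
     compatible_triple g XA XP XQ ->
     exists X : graded_derivation0 g,
       restrictions X XA XP XQ /\
       forall Y : graded_derivation0 g, restrictions Y XA XP XQ -> Y =1 X).
Proof.
split=> [X|XA XP XQ cX].
  exists (restrA_der X), (restrP_op X), (restrQ_op X).
  by split; [exact: restrictions_restr|exact: compatible_restr].
exists (extend_gder cX); split=> [|Y]; first exact: extend_restrictions.
by apply: restrictions_inj; exact: extend_restrictions.
Qed.
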